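(* Let \[N=\langle c,x,y,z \mid [x,y],\ [y,z],\ cxc^{-1}=z\rangle .\] If $N$ does not act properly, preserving factors, on any finite product of locally finite trees, then any right-angled Artin group whose defining graph contains the path on four vertices (three edges) as an induced subgraph has no proper action on a finite product of locally finite trees, with or without permuting factors.
   Context: The right-angled Artin group (RAAG) defined by a finite simplicial graph has one generator for each vertex, with defining relations that two generators commute whenever the corresponding vertices are joined by an edge. Trees are simplicial trees; locally finite means every vertex has finite degree. A group acts on a finite product of trees $P=T_1\times\cdots\times T_n$ by automorphisms of the natural cube complex structure; it preserves factors if the action is given by a homomorphism to $\mathrm{Aut}(T_1)\times\cdots\times\mathrm{Aut}(T_n)$, and otherwise it may permute factors. The action is proper if the stabiliser of every vertex of $P$ is finite. (The group $N$ is the index $2$ subgroup of $\langle a,b,t\mid tat^{-1}=ab,\ tbt^{-1}=b\rangle$ given by the kernel of the homomorphism to $C_2=\{0,1\}$ sending $a$ to $1$ and $b,t$ to $0$.) *)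

(* Defs.v *)
From HB Require Import structures.
From mathcomp Require Import all_boot.
From mathcomp Require Import boolp classical_sets functions cardinality.

Set Implicit Arguments.
Unset Strict Implicit.
Unset Printing Implicit Defensive.

Local Open Scope classical_set_scope.
Local Open Scope quotient_scope.

(* Group presentations. The letter (i, false) stands for the generator i, and *)
(* (i, true) for its inverse.                                                 *)

Notation letter I := (I * bool)%type.
Notation word I := (seq (letter I)).

Section Words.
Variable I : choiceType.

Definition inv_letter (a : letter I) : letter I := (a.1, ~~ a.2).
Definition inv_word (w : word I) : word I := rev (map inv_letter w).
Definition gen_word (i : I) : word I := [:: (i, false)].
Definition comm_word (u v : word I) : word I :=
  inv_word u ++ inv_word v ++ u ++ v.

End Words.

Section Presentation.
Variables (I : choiceType) (R : set (word I)).

Inductive word_equiv : word I -> word I -> Prop :=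
| word_equiv_refl u : word_equiv u u
| word_equiv_sym u v : word_equiv u v -> word_equiv v u
| word_equiv_trans u v w : word_equiv u v -> word_equiv v w -> word_equiv u w
| word_equiv_cancel u v a : word_equiv (u ++ a :: inv_letter a :: v) (u ++ v)
| word_equiv_relator u v r : R r -> word_equiv (u ++ r ++ v) (u ++ v).

Definition word_eqb : rel (word I) := fun u v => `[< word_equiv u v >].

Lemma word_eqb_refl : reflexive word_eqb.
Proof. by move=> u; apply/asboolP/word_equiv_refl. Qed.

Lemma word_eqb_sym : symmetric word_eqb.
Proof. by move=> u v; apply/asboolP/asboolP; apply: word_equiv_sym. Qed.

Lemma word_eqb_trans : transitive word_eqb.
Proof.
move=> v u w /asboolP uv /asboolP vw; apply/asboolP.
exact: word_equiv_trans uv vw.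
Qed.

Canonical word_equiv_rel : equiv_rel (word I) :=
  EquivRel word_eqb word_eqb_refl word_eqb_sym word_eqb_trans.

Definition presented : Type := {eq_quot word_equiv_rel}.
HB.instance Definition _ := 
  Choice.copy presented {eq_quot word_equiv_rel}.

Definition word_class (w : word I) : presented := \pi_({eq_quot word_equiv_rel}) w.

Lemma word_classP (u v : word I) : word_class u = word_class v <-> word_equiv u v.
Proof.
split=> [/eqmodP /asboolP //|uv].
by apply/eqmodP/asboolP.
Qed.

Lemma word_class_ind (P : presented -> Prop) :
  (forall w, P (word_class w)) -> forall g, P g.
Proof. by move=> Pw g; rewrite -[g]reprK; apply: Pw. Qed.

Lemma word_class_repr (w : word I) :
  word_equiv (repr (word_class w : {eq_quot word_equiv_rel})) w.
Proof. by apply/word_classP; apply: reprK. Qed.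

Lemma word_equiv_catl u v w : word_equiv u v -> word_equiv (w ++ u) (w ++ v).
Proof.
elim=> {u v} [u|u v _|u v t _ uv _|u v a|u v r Rr].
- exact: word_equiv_refl.
- exact: word_equiv_sym.
- exact: word_equiv_trans.
- by rewrite !catA; apply: word_equiv_cancel.
- by rewrite !(catA w); apply: word_equiv_relator.
Qed.

Lemma word_equiv_catr u v w : word_equiv u v -> word_equiv (u ++ w) (v ++ w).
Proof.
elim=> {u v} [u|u v _|u v t _ uv _|u v a|u v r Rr].
- exact: word_equiv_refl.
- exact: word_equiv_sym.
- exact: word_equiv_trans.
- by rewrite -!catA; apply: word_equiv_cancel.
- by rewrite -!catA; apply: word_equiv_relator.
Qed.

Lemma word_equiv_cat u u' v v' :
  word_equiv u u' -> word_equiv v v' -> word_equiv (u ++ v) (u' ++ v').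
Proof.
move=> uu' vv'; apply: word_equiv_trans (word_equiv_catl _ vv').
exact: word_equiv_catr.
Qed.

Lemma inv_letterK : involutive (@inv_letter I).
Proof. by case=> i b; rewrite /inv_letter /= negbK. Qed.

Lemma inv_wordK : involutive (@inv_word I).
Proof.
move=> w; rewrite /inv_word map_rev revK -map_comp map_id_in // => a _.
exact: inv_letterK.
Qed.

Lemma inv_word_cat (u v : word I) : inv_word (u ++ v) = inv_word v ++ inv_word u.
Proof. by rewrite /inv_word map_cat rev_cat. Qed.

Lemma word_equiv_mulwV w : word_equiv (w ++ inv_word w) [::].
Proof.
elim/last_ind: w => [|w a IH]; first exact: word_equiv_refl.
rewrite -cats1 inv_word_cat /= -catA /=.
exact: word_equiv_trans (word_equiv_cancel _ _ _) IH.
Qed.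

Lemma word_equiv_mulVw w : word_equiv (inv_word w ++ w) [::].
Proof. by rewrite -{2}[w]inv_wordK; apply: word_equiv_mulwV. Qed.

Lemma word_equiv_inv u v : word_equiv u v -> word_equiv (inv_word u) (inv_word v).
Proof.
move=> uv; have h1 := word_equiv_catl (inv_word u) (word_equiv_mulwV v).
have h2 := word_equiv_catr (inv_word v) (word_equiv_catl (inv_word u) uv).
have h3 := word_equiv_catr (inv_word v) (word_equiv_mulVw u).
rewrite cats0 catA in h1.
apply: word_equiv_trans (word_equiv_sym h1) _.
apply: word_equiv_trans (word_equiv_sym h2) h3.
Qed.

Definition presented_one : presented := word_class [::].
Definition presented_mul (g h : presented) : presented :=
  word_class (repr (g : {eq_quot word_equiv_rel}) ++
              repr (h : {eq_quot word_equiv_rel})).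
Definition presented_inv (g : presented) : presented :=
  word_class (inv_word (repr (g : {eq_quot word_equiv_rel}))).

Lemma presented_mulE u v :
  presented_mul (word_class u) (word_class v) = word_class (u ++ v).
Proof. by apply/word_classP; apply: word_equiv_cat; apply: word_class_repr. Qed.

Lemma presented_invE u : presented_inv (word_class u) = word_class (inv_word u).
Proof. by apply/word_classP; apply: word_equiv_inv; apply: word_class_repr. Qed.

Lemma presented_mulA : associative presented_mul.
Proof.
elim/word_class_ind=> u; elim/word_class_ind=> v; elim/word_class_ind=> w.
by rewrite !presented_mulE catA.
Qed.

Lemma presented_mul1g : left_id presented_one presented_mul.
Proof. by elim/word_class_ind=> u; rewrite presented_mulE. Qed.

Lemma presented_mulg1 : right_id presented_one presented_mul.
Proof. by elim/word_class_ind=> u; rewrite presented_mulE cats0. Qed.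

Lemma presented_mulVg : left_inverse presented_one presented_inv presented_mul.
Proof.
elim/word_class_ind=> u; rewrite presented_invE presented_mulE.
by apply/word_classP; apply: word_equiv_mulVw.
Qed.

Lemma presented_mulgV : right_inverse presented_one presented_inv presented_mul.
Proof.
elim/word_class_ind=> u; rewrite presented_invE presented_mulE.
by apply/word_classP; apply: word_equiv_mulwV.
Qed.

HB.instance Definition _ := isGroup.Build presented
  presented_mulA presented_mul1g presented_mulg1 presented_mulVg presented_mulgV.

End Presentation.

Definition raag (V : finType) (e : rel V) : groupType :=
  presented [set w | exists u v : V,
                       e u v /\ w = comm_word (gen_word u) (gen_word v)].

Definition N_c : 'I_4 := @Ordinal 4 0 isT.
Definition N_x : 'I_4 := @Ordinal 4 1 isT.
Definition N_y : 'I_4 := @Ordinal 4 2 isT.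
Definition N_z : 'I_4 := @Ordinal 4 3 isT.

Definition groupN : groupType :=
  let c := gen_word N_c in let x := gen_word N_x in
  let y := gen_word N_y in let z := gen_word N_z in
  presented [set w | [\/ w = comm_word x y,
                         w = comm_word y z |
                         w = c ++ x ++ inv_word c ++ inv_word z]].

Definition path_graph (n : nat) : rel 'I_n :=
  fun i j => (i.+1 == j :> nat) || (j.+1 == i :> nat).

Definition induced_subgraph (W V : finType) (eW : rel W) (eV : rel V) : Prop :=
  exists2 f : W -> V, injective f & forall u v, eV (f u) (f v) = eW u v.

(* Classically every type carries a choiceType structure and every relation   *)
(* is boolean, so these vertex sets and adjacency relations are arbitrary.    *)
(* Cycles of length at most 2 are excluded from the last axiom because        *)
(* [:: u; v] is a cycle of the relation as soon as u and v are adjacent.      *)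
Record tree : Type := Tree {
  tree_vertex :> choiceType;
  tree_adj : rel tree_vertex;
  tree_adj_sym : symmetric tree_adj;
  tree_adj_irr : irreflexive tree_adj;
  tree_inhabited : inhabited tree_vertex;
  tree_connected : forall u v : tree_vertex,
    exists2 p : seq tree_vertex, path tree_adj u p & last u p = v;
  tree_acyclic : forall p : seq tree_vertex,
    ucycle tree_adj p -> size p <= 2
}.

Definition locally_finite (T : tree) : Prop :=
  forall v : T, finite_set [set w | tree_adj v w].

Definition tree_automorphism (T : tree) (f : T -> T) : Prop :=
  bijective f /\ forall u v, tree_adj (f u) (f v) = tree_adj u v.

Section Actions.
Variables (G : groupType) (X : Type).

Definition is_action (act : G -> X -> X) : Prop :=
  (forall p, act 1%g p = p) /\
  (forall g h p, act (g * h)%g p = act g (act h p)).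

Definition proper_action (act : G -> X -> X) : Prop :=
  forall p, finite_set [set g | act g p = p].

End Actions.

(* The vertices of the product complex are the points of the product of the   *)
(* vertex sets. A cube is identified with its set of vertices, which          *)
(* determines it: it is a product of cells (vertices or edges) of the factors.*)
(* An automorphism is then a bijection of the vertices that maps cubes to     *)
(* cubes in both directions.                                                  *)
Section TreeProduct.
Variables (n : nat) (T : 'I_n -> tree).

Definition prod_vertex : Type := forall i : 'I_n, T i.

Definition tree_cell (S : tree) (A : set S) : Prop :=
  (exists v, A = [set v]) \/
  (exists u v, tree_adj u v /\ A = [set u; v]).

Definition prod_cube (C : set prod_vertex) : Prop :=
  exists A : forall i, set (T i),
    (forall i, tree_cell (A i)) /\ C = [set p | forall i, A i (p i)].

Definition prod_automorphism (f : prod_vertex -> prod_vertex) : Prop :=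
  bijective f /\ forall C, prod_cube (f @` C) <-> prod_cube C.

Variable G : groupType.

Definition prod_action (act : G -> prod_vertex -> prod_vertex) : Prop :=
  is_action act /\ forall g, prod_automorphism (act g).

Definition preserves_factors (act : G -> prod_vertex -> prod_vertex) : Prop :=
  exists rho : forall i, G -> T i -> T i,
    (forall i, is_action (rho i) /\ forall g, tree_automorphism (rho i g)) /\
    (forall g p i, act g p i = rho i g (p i)).

End TreeProduct.

Definition acts_properly (G : groupType) : Prop :=
  exists (n : nat) (T : 'I_n -> tree) (act : G -> prod_vertex T -> prod_vertex T),
    [/\ forall i, locally_finite (T i), prod_action act & proper_action act].

Definition acts_properly_preserving_factors (G : groupType) : Prop :=
  exists (n : nat) (T : 'I_n -> tree) (act : G -> prod_vertex T -> prod_vertex T),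
    [/\ forall i, locally_finite (T i), prod_action act, proper_action act &
        preserves_factors act].

(* Main.v *)
(* Write the path as p - q - r - s. For every k > 0 the assignment c |-> p^k s^k, *)
(* x |-> r^k, y |-> q^k, z |-> p^k r^k p^-k embeds N in the right-angled Artin    *)
(* group A. For k = 1 this is seen on two copies of N: there A acts with p and s  *)
(* exchanging the copies, and ps, r, q act on the first one as left translation   *)
(* by c, x, y. For larger k, any action of A on Y extends to an action on a       *)
(* larger set in which the k-th power of each generator acts on Y as the          *)
(* generator did.                                                                 *)
(*   An automorphism of a product of n trees permutes the directions of the       *)
(* edges, because two edges at a vertex span a square exactly when their          *)
(* directions differ. Hence its n!-th power preserves the factors, and the copy   *)
(* of N in A given by k = n! acts properly, preserving factors, as soon as A acts *)
(* properly.                                                                      *)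

Require Import Defs.
From mathcomp Require Import fingroup perm cyclic.
From mathcomp Require Import all_boot zify.
From mathcomp Require Import boolp classical_sets cardinality.

Set Implicit Arguments.
Unset Strict Implicit.
Unset Printing Implicit Defensive.

Local Open Scope classical_set_scope.
Local Open Scope quotient_scope.
Local Open Scope group_scope.

(** Suppose the right-angled Artin group A acts properly on a product of n locally finite trees. The
    elements keeping every edge direction form a subgroup, which contains all n!-th powers
    ([fixes_directions_exp_fact]), because every element permutes the n directions
    ([automorphism_maps_direction]). An element of this subgroup acts coordinate by coordinate
    ([fixes_directions_coord]). By [groupN_embeds] the subgroup generated by the n!-th powers of the
    vertex generators contains a copy of N. Restricted to that copy, the action is still proper and
    preserves the factors, which contradicts the hypothesis. Injectivity of the map from N to A is
    proved without normal forms: A acts on a set on which the image of an element k of N carries a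
    base point to a point from which k can be read off. This action is built in [raag_action_sheets]
    for first powers and lifted to higher powers by [raag_action_root]. *)

(** * Actions and homomorphisms out of a presented group *)

Section PresentedGroups.
Variables (I : choiceType) (R : set (word I)).

Definition presented_gen (i : I) : presented R := word_class R (gen_word i).

Lemma presented_ind (P : presented R -> Prop) :
  P 1 -> (forall i g, P g -> P (presented_gen i * g)) ->
  (forall i g, P g -> P ((presented_gen i)^-1 * g)) -> forall g, P g.
Proof.
move=> P1 Pgen PgenV; elim/word_class_ind; elim=> [|[i b] w Pw]; first exact: P1.
have -> : word_class R ((i, b) :: w) = word_class R [:: (i, b)] * word_class R w.
  exact/esym/presented_mulE.
case: b; last exact: Pgen.
suff -> : word_class R [:: (i, true)] = (presented_gen i)^-1 by apply: PgenV.
exact/esym/presented_invE.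
Qed.

(** Letters act from the right end of the word, as a left action requires; [g i] stands for the
    inverse of [f i]. *)
Definition word_act (X : Type) (f g : I -> X -> X) (w : word I) (x : X) : X :=
  foldr (fun a y => if a.2 then g a.1 y else f a.1 y) x w.

Lemma word_act_cat X (f g : I -> X -> X) u v x :
  word_act f g (u ++ v) x = word_act f g u (word_act f g v x).
Proof. exact: foldr_cat. Qed.

Lemma word_act_equiv X (f g : I -> X -> X) u v :
  (forall i, cancel (f i) (g i)) -> (forall i, cancel (g i) (f i)) ->
  (forall r x, R r -> word_act f g r x = x) ->
  word_equiv R u v -> word_act f g u =1 word_act f g v.
Proof.
move=> fK gK relK; elim=> {u v} [//|u v _ uv|u v t _ uv _ vt|u v a|u v r Rr] x.
- by rewrite uv.
- by rewrite uv vt.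
- rewrite !word_act_cat; congr (word_act _ _ _ _).
  by case: a => i [] /=; rewrite ?fK ?gK.
- by rewrite !word_act_cat (relK r).
Qed.

Lemma presented_action X (f g : I -> X -> X) :
  (forall i, cancel (f i) (g i)) -> (forall i, cancel (g i) (f i)) ->
  (forall r x, R r -> word_act f g r x = x) ->
  exists act : presented R -> X -> X,
    is_action act /\ forall i, act (presented_gen i) =1 f i.
Proof.
move=> fK gK relK.
pose act (h : presented R) := word_act f g (repr (h : {eq_quot _})).
have actE w : act (word_class R w) =1 word_act f g w.
  exact: word_act_equiv (word_class_repr _ _).
exists act; split=> [|i x]; last by rewrite actE.
split=> [x|]; first exact: actE.
elim/word_class_ind=> u; elim/word_class_ind=> v x.
rewrite -[_ * _]/(presented_mul _ _) presented_mulE !actE word_act_cat.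
by rewrite -(actE v).
Qed.

(** Obtained from [presented_action] by letting the generators act on [H] by left translation; the
    homomorphism is the orbit map of 1. *)
Lemma presented_hom (H : groupType) (h : I -> H) :
  (forall r, R r -> \prod_(a <- r) (if a.2 then (h a.1)^-1 else h a.1) = 1) ->
  exists phi : presented R -> H,
    [/\ phi 1 = 1, {morph phi : x y / x * y} &
        forall i, phi (presented_gen i) = h i].
Proof.
move=> relK.
pose f i x := h i * x; pose g i x := (h i)^-1 * x.
have fgE w x : word_act f g w x =
    (\prod_(a <- w) (if a.2 then (h a.1)^-1 else h a.1)) * x.
  elim: w x => [|[i b] w IH] x /=; first by rewrite big_nil mul1g.
  by rewrite big_cons -mulgA -IH; case: b.
have [||r x Rr|act [[act1 actM] act_gen]] := @presented_action H f g.
- by move=> i x; rewrite /f /g mulKg.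
- by move=> i x; rewrite /f /g mulVKg.
- by rewrite fgE relK ?mul1g.
(* The action commutes with right translations, so each element acts as left translation by its
   value at 1. *)
have actE u x : act u x = act u 1 * x.
  elim/presented_ind: u x => [|i u IH|i u IH] x.
  - by rewrite !act1 mul1g.
  - by rewrite !actM !act_gen /f IH mulgA.
  - have genV y : act (presented_gen i)^-1 y = (h i)^-1 * y.
      apply: (mulgI (h i)); rewrite mulVKg -[LHS]/(f i _) -act_gen -actM.
      by rewrite mulgV act1.
    by rewrite !actM !genV IH mulgA.
exists (act ^~ 1); split=> [|u v|i]; first by rewrite act1.
  by rewrite actM actE.
by rewrite act_gen /f mulg1.
Qed.

End PresentedGroups.

Lemma actionK (G : groupType) X (act : G -> X -> X) (g : G) :
  is_action act -> cancel (act g) (act g^-1).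
Proof. by move=> [act1 actM] x; rewrite -actM mulVg act1. Qed.

Lemma actionVK (G : groupType) X (act : G -> X -> X) (g : G) :
  is_action act -> cancel (act g^-1) (act g).
Proof. by move=> [act1 actM] x; rewrite -actM mulgV act1. Qed.

Lemma action_bij (G : groupType) X (act : G -> X -> X) (g : G) :
  is_action act -> bijective (act g).
Proof.
by move=> actP; exists (act g^-1); [apply: actionK|apply: actionVK].
Qed.

Lemma actionX (G : groupType) X (act : G -> X -> X) (g : G) k :
  is_action act -> act (g ^+ k) =1 iter k (act g).
Proof.
move=> [act1 actM] x; elim: k => [|k IH]; first by rewrite act1.
by rewrite expgS actM IH.
Qed.

(** * Actions of right-angled Artin groups and roots of generators *)

Section Raag.
Variables (V : finType) (e : rel V).

Definition raag_gen (v : V) : raag e := presented_gen _ v.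

Lemma raag_gen_commute u v : e u v -> commute (raag_gen u) (raag_gen v).
Proof.
move=> euv; apply/commgP/eqP.
set R := [set w | exists u v : V, e u v /\ w = comm_word (gen_word u) (gen_word v)].
have commE : [~ raag_gen u, raag_gen v] =
    word_class R (comm_word (gen_word u) (gen_word v)).
  by rewrite /comm_word -!presented_mulE -!presented_invE.
rewrite commE; apply/word_classP.
have rel := @word_equiv_relator _ R [::] [::] (comm_word (gen_word u) (gen_word v)).
by rewrite cats0 in rel; apply: rel; exists u, v.
Qed.

Lemma raag_action X (f g : V -> X -> X) :
  (forall v, cancel (f v) (g v)) -> (forall v, cancel (g v) (f v)) ->
  (forall u v x, e u v -> f u (f v x) = f v (f u x)) ->
  exists act : raag e -> X -> X,
    is_action act /\ forall v, act (raag_gen v) =1 f v.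
Proof.
move=> fK gK fC; apply: (presented_action fK gK) => _ x [u [v [euv ->]]] /=.
by rewrite fC // fK fK.
Qed.

(* An odometer with [m.+1] digits at every vertex, whose carry acts on [Y], *)
(* provides the roots.                                                      *)
Lemma raag_action_root Y (act : raag e -> Y -> Y) (m : nat) :
  irreflexive e -> is_action act ->
  exists (Z : Type) (i : Y -> Z) (p : Z -> Y) (actZ : raag e -> Z -> Z),
    [/\ cancel i p, is_action actZ &
        forall v y, actZ (raag_gen v ^+ m.+1) (i y) = i (act (raag_gen v) y)].
Proof.
move=> e_irr actP; have [act1 actM] := actP.
pose D : Type := {ffun V -> 'I_m.+1}.
pose upd (d : D) v (a : 'I_m.+1) : D := [ffun w => if w == v then a else d w].
have updv d v a : upd d v a v = a by rewrite ffunE eqxx.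
have updw d v a w : w != v -> upd d v a w = d w by move=> /negPf wv; rewrite ffunE wv.
have upd_upd d v a b : upd (upd d v a) v b = upd d v b.
  by apply/ffunP=> w; rewrite !ffunE; case: eqP.
have upd_id d v : upd d v (d v) = d.
  by apply/ffunP=> w; rewrite ffunE; case: eqP => // ->.
(* The generator [v] advances the digit at [v]; it touches [Y] only when that digit wraps around,
   once in [m.+1] applications. *)
pose f v (z : Y * D) : Y * D :=
  (if z.2 v == ord_max then act (raag_gen v) z.1 else z.1,
   upd z.2 v (ordS (z.2 v))).
pose g v (z : Y * D) : Y * D :=
  (if z.2 v == ord0 then act (raag_gen v)^-1 z.1 else z.1,
   upd z.2 v (ord_pred (z.2 v))).
have ordS_eq0 (a : 'I_m.+1) : (ordS a == ord0) = (a == ord_max).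
  by rewrite -(inj_eq (can_inj (@ordSK _)) a); congr (_ == _); apply/val_inj;
    rewrite /= modnn.
have ord_pred_eq_max (a : 'I_m.+1) : (ord_pred a == ord_max) = (a == ord0).
  by rewrite -ordS_eq0 ord_predK.
have fK v : cancel (f v) (g v).
  case=> y d; rewrite /f /g /= updv upd_upd ordSK upd_id ordS_eq0.
  by case: eqP => // _; rewrite actionK.
have gK v : cancel (g v) (f v).
  case=> y d; rewrite /f /g /= updv upd_upd ord_predK upd_id ord_pred_eq_max.
  by case: eqP => // _; rewrite actionVK.
have fC u v z : e u v -> f u (f v z) = f v (f u z).
  move=> euv; have uv : u != v by apply: contraTneq euv => ->; rewrite e_irr.
  rewrite /f /= !updw // 1?eq_sym //; congr (_, _).
    by do 2 case: eqP => //; rewrite -!actM (raag_gen_commute euv).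
  apply/ffunP=> w; rewrite !ffunE.
  by case: (w =P u) => // ->; rewrite (negPf uv).
have [actZ [actZP actZ_gen]] := raag_action fK gK fC.
exists (Y * D)%type, (fun y => (y, [ffun=> ord0])), fst, actZ; split=> // v y.
rewrite actionX //.
(* Starting from digit 0, the first [m] applications produce no carry; the next one carries and
   resets the digit. *)
have odo t : t <= m ->
    iter t (actZ (raag_gen v)) (y, [ffun=> ord0]) = (y, upd [ffun=> ord0] v (inord t)).
  elim: t => [_|t IH tm].
    congr (_, _); apply/ffunP=> w; rewrite !ffunE; case: eqP => // _.
    by apply/val_inj; rewrite /= inordK.
  rewrite iterS IH 1?ltnW // actZ_gen /f /= updv upd_upd; congr (_, _).
    case: eqP => // /(congr1 val) /=; rewrite inordK 1?ltnW // => tE.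
    by rewrite tE ltnn in tm.
  congr upd; apply/val_inj; rewrite /= !inordK ?modn_small //; lia.
rewrite iterS odo // actZ_gen /f /= updv upd_upd.
have -> : inord m = ord_max :> 'I_m.+1 by apply/val_inj; rewrite /= inordK.
rewrite eqxx; congr (_, _); apply/ffunP=> w; rewrite !ffunE; case: eqP => // _.
by apply/val_inj; rewrite /= modnn.
Qed.

End Raag.

(** * Embedding N by powers of the generators of an induced path *)

Definition N_gen (i : 'I_4) : groupN := presented_gen _ i.

Lemma N_gen_relations :
  [/\ commute (N_gen N_x) (N_gen N_y), commute (N_gen N_y) (N_gen N_z) &
      N_gen N_c * N_gen N_x = N_gen N_z * N_gen N_c].
Proof.
pose R := [set w : word 'I_4 | [\/ w = comm_word (gen_word N_x) (gen_word N_y),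
    w = comm_word (gen_word N_y) (gen_word N_z) |
    w = gen_word N_c ++ gen_word N_x ++ inv_word (gen_word N_c) ++
        inv_word (gen_word N_z)]].
have rel r : R r -> word_class R r = 1.
  move=> Rr; apply/word_classP; have := @word_equiv_relator _ R [::] [::] r Rr.
  by rewrite cats0.
split.
- apply/commgP/eqP; rewrite -(rel (comm_word (gen_word N_x) (gen_word N_y))).
    by rewrite /comm_word -!presented_mulE -!presented_invE.
  by constructor 1.
- apply/commgP/eqP; rewrite -(rel (comm_word (gen_word N_y) (gen_word N_z))).
    by rewrite /comm_word -!presented_mulE -!presented_invE.
  by constructor 2.
- apply: (mulIg (N_gen N_c)^-1); apply: (mulIg (N_gen N_z)^-1).
  rewrite mulgK mulgV -!mulgA -(rel (gen_word N_c ++ gen_word N_x ++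
    inv_word (gen_word N_c) ++ inv_word (gen_word N_z))).
    by rewrite -!presented_mulE -!presented_invE.
  by constructor 3.
Qed.

Lemma ord4P (i : 'I_4) : [\/ i = N_c, i = N_x, i = N_y | i = N_z].
Proof.
by case: i => [[|[|[|[|//]]]] lti];
  [constructor 1|constructor 2|constructor 3|constructor 4]; apply/val_inj.
Qed.

Section Embedding.
Variables (V : finType) (e : rel V) (f : 'I_4 -> V).
Hypothesis e_irr : irreflexive e.
Hypothesis f_inj : injective f.
Hypothesis f_path : forall u v, e (f u) (f v) = @path_graph 4 u v.

Local Notation p := (f (@Ordinal 4 0 isT)).
Local Notation q := (f (@Ordinal 4 1 isT)).
Local Notation r := (f (@Ordinal 4 2 isT)).
Local Notation s := (f (@Ordinal 4 3 isT)).

(** Since the path is induced, an edge with both ends on it is one of its three edges, in either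
    orientation. Every other edge has an end outside the path. *)
Lemma raag_edge_ind u v (P : V -> V -> Prop) : e u v ->
  P p q -> P q r -> P r s -> P q p -> P r q -> P s r ->
  (forall w, w \notin [:: p; q; r; s] -> P w v /\ P u w) -> P u v.
Proof.
move=> euv Ppq Pqr Prs Pqp Prq Psr Pout.
have [/codomP [i uE]|uout] := boolP (u \in codom f); last first.
  have /Pout [] // : u \notin [:: p; q; r; s].
  apply: contra uout; rewrite !inE => /or4P [] /eqP ->; exact: codom_f.
have [/codomP [j vE]|vout] := boolP (v \in codom f); last first.
  have /Pout [] // : v \notin [:: p; q; r; s].
  apply: contra vout; rewrite !inE => /or4P [] /eqP ->; exact: codom_f.
move: euv; rewrite {}uE {}vE f_path.
by case: (ord4P i) => ->; case: (ord4P j) => ->.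
Qed.

(* The second sheet is the first one shifted by [c], whence [q] acts on it as *)
(* the conjugate [y ^ c] and commutes with [p], which swaps the two sheets.   *)
Lemma raag_action_sheets :
  exists act : raag e -> groupN * bool -> groupN * bool,
  is_action act /\ forall n,
    [/\ forall b, act (raag_gen e p) (n, b) =
          (if b then N_gen N_c * n else (N_gen N_c)^-1 * n, ~~ b),
        act (raag_gen e q) (n, false) = (N_gen N_y * n, false),
        forall b, act (raag_gen e r) (n, b) = (N_gen N_x * n, b) &
        forall b, act (raag_gen e s) (n, b) = (n, ~~ b)].
Proof.
have [xy yz cx] := N_gen_relations.
set c := N_gen N_c in xy yz cx *; set x := N_gen N_x in xy yz cx *.
set y := N_gen N_y in xy yz cx *; set z := N_gen N_z in xy yz cx *.
(* Conjugating the relation between [y] and [z] by [c] gives this; it makes [q] and [r] commute on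
   the second sheet. *)
have yc_x : commute (y ^ c) x.
  have -> : x = z ^ c by rewrite conjgE -cx mulKg.
  by rewrite /commute -!conjMg yz.
pose X := (groupN * bool)%type.
pose fp (a : X) : X := (if a.2 then c * a.1 else c^-1 * a.1, ~~ a.2).
pose fq (a : X) : X := (if a.2 then y ^ c * a.1 else y * a.1, a.2).
pose gq (a : X) : X := (if a.2 then (y ^ c)^-1 * a.1 else y^-1 * a.1, a.2).
pose fr (a : X) : X := (x * a.1, a.2).
pose gr (a : X) : X := (x^-1 * a.1, a.2).
pose fs (a : X) : X := (a.1, ~~ a.2).
pose F v := if v == p then fp else if v == q then fq else
            if v == r then fr else if v == s then fs else id.
(* [fp] and [fs] are involutions, hence their own inverses. *)
pose G v := if v == p then fp else if v == q then gq else
            if v == r then gr else if v == s then fs else id.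
have Fp : F p = fp by rewrite /F eqxx.
have Fq : F q = fq by rewrite /F !(inj_eq f_inj).
have Fr : F r = fr by rewrite /F !(inj_eq f_inj).
have Fs : F s = fs by rewrite /F !(inj_eq f_inj).
have Fout w : w \notin [:: p; q; r; s] -> F w = id.
  by rewrite !inE !negb_or /F => /and4P [/negPf -> /negPf -> /negPf -> /negPf ->].
have pq a : fp (fq a) = fq (fp a).
  case: a => n []; rewrite /fp /fq /= !mulgA; first by rewrite mulgV mul1g.
  by rewrite conjgE !mulgA mulgK.
have qr a : fq (fr a) = fr (fq a).
  case: a => n []; rewrite /fq /fr /=; first by rewrite mulgA yc_x -mulgA.
  by rewrite mulgA -xy -mulgA.
have [||u v a euv|act [actP act_gen]] := @raag_action V e X F G.
- move=> v [n b]; rewrite /F /G.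
  case: (v == p); first by case: b; rewrite /fp /= ?mulKg ?mulVKg.
  case: (v == q); first by case: b; rewrite /fq /gq /= mulKg.
  case: (v == r); first by rewrite /fr /gr /= mulKg.
  by case: (v == s) => //; rewrite /fs /= negbK.
- move=> v [n b]; rewrite /F /G.
  case: (v == p); first by case: b; rewrite /fp /= ?mulKg ?mulVKg.
  case: (v == q); first by case: b; rewrite /fq /gq /= mulVKg.
  case: (v == r); first by rewrite /fr /gr /= mulVKg.
  by case: (v == s) => //; rewrite /fs /= negbK.
- apply: (@raag_edge_ind u v (fun u v => F u (F v a) = F v (F u a))) => //;
    try by rewrite ?Fp ?Fq ?Fr ?Fs ?pq ?qr.
  by move=> w /Fout ->.
exists act; split=> // n; split=> *; by rewrite act_gen ?Fp ?Fq ?Fr ?Fs.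
Qed.

(** The predicate [K] ranges over subgroups, so the last clause places the image in the subgroup
    generated by the [m.+1]-st powers. The retraction [psi] reads the first sheet coordinate of the
    translate of the base point [i (1, false)]. *)
Lemma groupN_embeds (m : nat) :
  exists (phi : groupN -> raag e) (psi : raag e -> groupN),
  [/\ phi 1 = 1, {morph phi : g h / g * h}, cancel phi psi &
      forall K : raag e -> Prop,
        K 1 -> (forall g h, K g -> K h -> K (g * h)) ->
        (forall g, K g -> K g^-1) -> (forall v, K (raag_gen e v ^+ m.+1)) ->
      forall n, K (phi n)].
Proof.
pose P := raag_gen e p ^+ m.+1; pose Q := raag_gen e q ^+ m.+1.
pose U := raag_gen e r ^+ m.+1; pose S := raag_gen e s ^+ m.+1.
have PQ : commute P Q by apply/commuteX2/raag_gen_commute; rewrite f_path.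
have QU : commute Q U by apply/commuteX2/raag_gen_commute; rewrite f_path.
have US : commute U S by apply/commuteX2/raag_gen_commute; rewrite f_path.
(* Images of [c], [x], [y], [z] in this order. The relation between [c], [x] and [z] holds because
   [S] commutes with [U]. *)
pose h (i : 'I_4) : raag e := nth 1 [:: P * S; U; Q; P * U * P^-1] i.
have : exists phi : groupN -> raag e,
    [/\ phi 1 = 1, {morph phi : g h / g * h} & forall j, phi (N_gen j) = h j].
  apply: presented_hom => w.
  have QP : commute Q P by apply: esym.
  move=> [] ->; rewrite /comm_word /inv_word /= !big_cons big_nil /h /= mulg1.
  - by rewrite -[LHS]/[~ U, Q]; apply/eqP/commgP/esym.
  - rewrite -[LHS]/[~ Q, P * U * P^-1]; apply/eqP/commgP.
    by apply/commuteM/commuteV => //; apply: commuteM.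
  - by rewrite !invgM invgK !mulgA mulgVK -(mulgA P) -US mulgA !mulgK mulgV.
move=> [phi [phi1 phiM phi_gen]].
have phiV g : phi g^-1 = (phi g)^-1.
  by apply: (mulgI (phi g)); rewrite -phiM !mulgV.
have [act [actP act_gen]] := raag_action_sheets.
have [Z [i [pr [actZ [iK actZP actZ_gen]]]]] := raag_action_root m e_irr actP.
exists phi, (fun g => (pr (actZ g (i (1, false)))).1); split=> //.
- have act_P n b : actZ P (i (n, b)) =
      i (if b then N_gen N_c * n else (N_gen N_c)^-1 * n, ~~ b).
    by rewrite actZ_gen; have [->] := act_gen n.
  have act_PV n : actZ P^-1 (i (n, false)) = i ((N_gen N_c)^-1 * n, true).
    apply: (can_inj (actionK P actZP)).
    by rewrite (actionVK _ actZP) act_P mulVKg.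
  have act_U n b : actZ U (i (n, b)) = i (N_gen N_x * n, b).
    by rewrite actZ_gen; have [_ _ ->] := act_gen n.
  (* On the first sheet each image acts as left translation by its generator; for [z] this is the
     relation [c x = z c] in N. *)
  have act_h j n : actZ (h j) (i (n, false)) = i (N_gen j * n, false).
    have [_ actZM] := actZP; rewrite /h.
    case: (ord4P j) => -> /=.
    + by rewrite actZM actZ_gen; have [_ _ _ ->] := act_gen n; rewrite act_P.
    + exact: act_U.
    + by rewrite actZ_gen; have [_ ->] := act_gen n.
    + have [_ _ cx] := N_gen_relations.
      by rewrite !actZM act_PV act_U act_P !mulgA cx mulgK.
  have act_phi k l : actZ (phi k) (i (l, false)) = i (k * l, false).
    have [actZ1 actZM] := actZP.
    elim/presented_ind: k l => [|j k IH|j k IH] l.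
    + by rewrite phi1 actZ1 mul1g.
    + by rewrite phiM actZM IH phi_gen act_h mulgA.
    + rewrite phiM actZM IH phiV phi_gen; apply: (can_inj (actionK (h j) actZP)).
      by rewrite (actionVK _ actZP) act_h -mulgA mulVKg.
  by move=> n; rewrite act_phi iK mulg1.
- move=> K K1 KM KV Kgen.
  have Kh j : K (h j).
    by rewrite /h; case: (ord4P j) => -> /=; do ?[exact: Kgen|apply/KV|apply/KM].
  elim/presented_ind=> [|j g IH|j g IH]; first by rewrite phi1.
    by rewrite phiM phi_gen; apply: KM.
  by rewrite phiM phiV phi_gen; apply: KM => //; apply: KV.
Qed.

End Embedding.

(** * Edges, directions and squares in a product of trees *)

Section TreeProducts.
Variables (n : nat) (T : 'I_n -> tree).
Implicit Types p q u w t : prod_vertex T.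

Definition dir_adj (i : 'I_n) p q : Prop :=
  tree_adj (p i) (q i) /\ forall j, j != i -> p j = q j.

Definition prod_adj p q : Prop := exists i, dir_adj i p q.

Lemma tree_adj_neq (S : tree) (a b : S) : tree_adj a b -> a <> b.
Proof. by move=> ab E; rewrite E tree_adj_irr in ab. Qed.

Lemma dir_adj_sym i p q : dir_adj i p q -> dir_adj i q p.
Proof.
move=> [pq pqE]; split; first by rewrite tree_adj_sym.
by move=> j /pqE.
Qed.

Lemma dir_adj_eq i p q j : dir_adj i p q -> p j <> q j -> j = i.
Proof. by move=> [_ pqE] pq; apply: contra_notP pq => /eqP /pqE. Qed.

Lemma dir_adj_uniq i j p q : dir_adj i p q -> dir_adj j p q -> i = j.
Proof. by move=> [/tree_adj_neq pq _] /dir_adj_eq; apply. Qed.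

Lemma dir_adj_dfwith i p (a : T i) :
  tree_adj (p i) a -> dir_adj i p (dfwith p a).
Proof.
move=> pa; split; first by rewrite dfwith_in.
by move=> j ji; rewrite dfwith_out // eq_sym.
Qed.

(** The fourth corner takes coordinate [j] from [w] and all others from [u]. *)
Lemma square_complete i j p u w :
  dir_adj i p u -> dir_adj j p w -> i != j ->
  exists t, [/\ t <> p, dir_adj j u t & dir_adj i w t].
Proof.
move=> [pu puE] [pw pwE] ij; exists (dfwith u (w j)); split.
- move=> /(congr1 (fun t => t j)); rewrite dfwith_in => wp.
  exact: (tree_adj_neq pw).
- by apply: dir_adj_dfwith; rewrite -puE // eq_sym.
- split; first by rewrite dfwith_out 1?eq_sym // -pwE.
  move=> k ki; case: (eqVneq j k) => [<-|jk]; first by rewrite dfwith_in.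
  by rewrite dfwith_out // -puE // -pwE // eq_sym.
Qed.

(* Two edges of a tree do not span a square. *)
Lemma square_dirs i j i' j' p u t w :
  dir_adj i p u -> dir_adj j u t -> dir_adj i' w t -> dir_adj j' p w ->
  p <> t -> u <> w -> i != j' /\ i = i'.
Proof.
(* Two sides at [p1] with the same direction force all four sides into that direction, giving a
   4-cycle in a single tree. *)
have no_square i1 j1 i2 p1 u1 t1 w1 : dir_adj i1 p1 u1 -> dir_adj j1 u1 t1 ->
    dir_adj i2 w1 t1 -> dir_adj i1 p1 w1 -> p1 <> t1 -> u1 <> w1 -> False.
  move=> [pu puE] ut wt [pw pwE] pt uw.
  have uw1 k : k != i1 -> u1 k = w1 k by move=> ki; rewrite -puE ?pwE.
  have uwi : u1 i1 <> w1 i1.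
    move=> uwi; apply: uw; apply: functional_extensionality_dep => k.
    by case: (eqVneq k i1) => [->|/uw1].
  have [j1E|/eqP ji] := pselect (j1 = i1); last first.
    have tw : w1 i1 <> t1 i1.
      by case: ut => _ <- //; [exact/nesym|rewrite eq_sym].
    have i2E := dir_adj_eq wt tw; case: wt ut => _ wtE [ut _].
    by apply: (tree_adj_neq ut); rewrite -wtE -?i2E // uw1.
  have [i2E|/eqP i21] := pselect (i2 = i1); last first.
    have tu : u1 i1 <> t1 i1.
      by case: wt => _ <- //; rewrite eq_sym.
    case: ut wt => ut utE [wt _].
    by apply: (tree_adj_neq wt); rewrite -utE -?uw1 // j1E.
  subst j1 i2; case: ut wt => [ut utE] [wt wtE].
  have pti : p1 i1 <> t1 i1.
    move=> pti; apply: pt; apply: functional_extensionality_dep => k.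
    by case: (eqVneq k i1) => [->//|ki]; rewrite puE ?utE.
  suff /tree_acyclic : ucycle (@tree_adj (T i1)) [:: p1 i1; u1 i1; t1 i1; w1 i1].
    by [].
  apply/andP; split.
    by rewrite /= pu ut (tree_adj_sym (t1 i1)) wt (tree_adj_sym (w1 i1)) pw.
  rewrite /= !inE !negb_or; do ![apply/andP; split] => //; apply/eqP => //;
    by [exact: tree_adj_neq|apply/nesym/tree_adj_neq].
move=> pu ut wt pw pt uw.
have ij' : i != j'.
  by apply/eqP=> E; rewrite -E in pw; apply: no_square pu ut wt pw pt uw.
split=> //.
(* The same argument at the corner [u]. Coordinate [i] is then constant along [u t] and along [p w]
   but changes along [p u], so it changes along [w t]. *)
have ij : i != j.
  apply/eqP=> E; rewrite -E in ut.
  apply: (no_square _ _ _ _ _ _ _ (dir_adj_sym pu) pw (dir_adj_sym wt) ut uw pt).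
apply: (dir_adj_eq wt).
case: pw => _ <- //; case: ut => _ <- //.
by case: pu => /tree_adj_neq.
Qed.

(** Connectedness of the product, using only directions in [A]: the coordinates in [A] are corrected
    one after another, each along a path in its tree. *)
Lemma prod_vertex_ind (A : pred 'I_n) (P : prod_vertex T -> Prop) p p' :
  (forall j, ~~ A j -> p j = p' j) ->
  (forall j q q', A j -> dir_adj j q q' -> P q -> P q') -> P p -> P p'.
Proof.
move=> pp' step Pp.
have walk j l q : A j -> path (@tree_adj (T j)) (q j) l -> P q ->
    P (dfwith q (last (q j) l)).
  move=> Aj; elim: l q => [|a l IH] q /=.
    have -> // : dfwith q (q j) = q.
    by apply: functional_extensionality_dep => k; case: dfwithP.
  move=> /andP [qa al] Pq.
  have := IH (dfwith q a); rewrite dfwith_in => /(_ al (step _ _ _ Aj _ Pq)).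
  move=> /(_ (dir_adj_dfwith qa)); congr P.
  by apply: functional_extensionality_dep => k; case: dfwithP => [|k' jk];
    rewrite ?dfwith_in ?dfwith_out.
have : forall j, j \notin enum A -> p j = p' j by move=> j; rewrite mem_enum => /pp'.
have : {subset enum A <= A} by move=> j; rewrite mem_enum.
elim: (enum A) p Pp {pp'} => [|j s IH] p Pp sA pp'.
  suff <- : p = p' by [].
  by apply: functional_extensionality_dep => k; apply: pp'.
have [l pl plE] := tree_connected (p j) (p' j).
apply: (IH (dfwith p (p' j))).
- by rewrite -plE; apply: walk => //; apply: sA; rewrite mem_head.
- by move=> k ks; apply: sA; rewrite inE ks orbT.
- move=> k ks; case: (eqVneq j k) => [<-|jk]; first by rewrite dfwith_in.
  by rewrite dfwith_out // pp' // inE negb_or eq_sym jk.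
Qed.

(** This recovers adjacency from the cube structure, which is all that [prod_automorphism]
    mentions. *)
Lemma prod_cube_edge p q : p <> q -> prod_cube [set p; q] <-> prod_adj p q.
Proof.
move=> pq; split=> [[A [cellA AE]]|[i [pqi pqE]]].
  have pA k : A k (p k) by have : [set p; q] p by [left]; rewrite AE.
  have qA k : A k (q k) by have : [set p; q] q by [right]; rewrite AE.
  have [i pqi] : exists i, p i <> q i.
    apply: contra_notP pq => /forallNP pq.
    by apply: functional_extensionality_dep => k; apply: contrapT (pq k).
  exists i; split.
    case: (cellA i) (pA i) (qA i) => [[v ->] /= pv qv|[u [v [uv ->]]] /= pu qu].
      by rewrite pv qv in pqi.
    by case: pu qu pqi => -> [] -> // _; rewrite tree_adj_sym.
  move=> j ji; apply: contrapT => pqj.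
  (* If [p] and [q] also differed at [j], changing only coordinate [j] of [p] would give a third
     vertex of the cube. *)
  have : [set p; q] (dfwith p (q j)).
    by rewrite AE => k; case: dfwithP.
  case=> /= E.
    by apply: pqj; rewrite -[in LHS]E dfwith_in.
  by apply: pqi; rewrite -[in RHS]E dfwith_out.
exists (fun k => [set p k; q k]); split.
  move=> k; case: (eqVneq k i) => [->|ki].
    by right; exists (p i), (q i).
  by left; exists (p k); rewrite -pqE // setUid.
apply/seteqP; split=> [t [] -> k /=|t tpq]; [by left|by right|].
have tE k : k != i -> t k = p k by move=> ki; have [|->] := tpq k; rewrite // -pqE.
have [tp|tq] := tpq i; [left|right]; apply: functional_extensionality_dep => k.
  by case: (eqVneq k i) => [->|/tE].
by case: (eqVneq k i) => [->|ki] //; rewrite tE // pqE.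
Qed.

Lemma prod_automorphism_adj f p q :
  prod_automorphism f -> prod_adj p q -> prod_adj (f p) (f q).
Proof.
move=> [/bij_inj f_inj f_cube] pq.
have pq_neq : p <> q.
  by case: pq => i [/tree_adj_neq pq _] E; apply: pq; rewrite E.
have /prod_cube_edge <- : f p <> f q by move=> /f_inj.
rewrite -[[set f p]]image_set1 -[[set f q]]image_set1 -image_setU.
exact/f_cube/prod_cube_edge.
Qed.

(** * Automorphisms permute the directions *)

Section AdjacencyAutomorphisms.
Variables f f' : prod_vertex T -> prod_vertex T.
Hypotheses (fK : cancel f f') (f'K : cancel f' f).
Hypothesis f_adj : forall p q, prod_adj p q -> prod_adj (f p) (f q).
Hypothesis f'_adj : forall p q, prod_adj p q -> prod_adj (f' p) (f' q).

Definition maps_direction (g : prod_vertex T -> prod_vertex T) i j : Prop :=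
  forall p q, dir_adj i p q -> dir_adj j (g p) (g q).

(** If the image directions differed, the image edges would span a square; its preimage under [f]
    would be a square with two sides of direction [i] at [p], excluded by [square_dirs]. *)
Lemma same_direction_star i j j' p u w : dir_adj i p u -> dir_adj i p w ->
  dir_adj j (f p) (f u) -> dir_adj j' (f p) (f w) -> j = j'.
Proof.
move=> pu pw fpu fpw.
have [uw|uw] := pselect (u = w).
  by rewrite uw in fpu; apply: dir_adj_uniq fpu fpw.
apply: contrapT => /eqP jj'.
have [t [tp fut fwt]] := square_complete fpu fpw jj'.
have [k ut] : prod_adj u (f' t) by rewrite -[u]fK; apply: f'_adj; exists j'.
have [l wt] : prod_adj w (f' t) by rewrite -[w]fK; apply: f'_adj; exists j.
have pt : p <> f' t by move=> E; apply: tp; rewrite E f'K.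
by have [] := square_dirs pu ut wt pw pt uw; rewrite eqxx.
Qed.

(** The image direction is constant on the [i]-edges at one vertex by [same_direction_star], and it
    spreads to all vertices by connectedness. *)
Lemma automorphism_maps_direction i : exists j, maps_direction f i j.
Proof.
have [[p0 [q0 pq0]]|no_edge] := pselect (exists p q, dir_adj i p q); last first.
  by exists i => p q pq; case: no_edge; exists p, q.
have [j fpq0] : prod_adj (f p0) (f q0) by apply: f_adj; exists i.
exists j => p; pose star p := forall q, dir_adj i p q -> dir_adj j (f p) (f q).
apply: (@prod_vertex_ind predT star p0) => // [k r r' _ rr' r_star q r'q|q pq].
  have [j' fr'q] : prod_adj (f r') (f q) by apply: f_adj; exists i.
  suff -> : j = j' by [].
  (* If the step is itself an [i]-edge, it belongs to the stars of both its ends. Otherwise it spans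
     a square with the given [i]-edge, and opposite sides of the image square have equal
     direction. *)
  case: (eqVneq i k) rr' => [<-|ik] rr'.
    apply: same_direction_star (dir_adj_sym rr') r'q _ fr'q.
    exact/dir_adj_sym/r_star.
  have [s [sr' qs rs]] := square_complete r'q (dir_adj_sym rr') ik.
  have frs := r_star s rs.
  have [k1 fqs] : prod_adj (f q) (f s) by apply: f_adj; exists k.
  have [k2 fr'r] : prod_adj (f r') (f r) by apply: f_adj; exists k; apply: dir_adj_sym.
  have [] // := square_dirs fr'q fqs frs fr'r.
  - by move=> /(can_inj fK) E; apply: sr'.
  - move=> /(can_inj fK) E; rewrite E in r'q.
    by move/eqP: ik; apply; apply: dir_adj_uniq r'q (dir_adj_sym rr').
have [j' fpq] : prod_adj (f p0) (f q) by apply: f_adj; exists i.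
by rewrite (same_direction_star pq0 pq fpq0 fpq).
Qed.

End AdjacencyAutomorphisms.

(** * Actions that keep every direction *)

Section ProductActions.
Variables (G : groupType) (act : G -> prod_vertex T -> prod_vertex T).
Hypothesis act_prod : prod_action act.

Let actP : is_action act. Proof. by case: act_prod. Qed.

Let act_adj g p q : prod_adj p q -> prod_adj (act g p) (act g q).
Proof. by apply: prod_automorphism_adj; case: act_prod. Qed.

Lemma action_maps_direction g i : exists j, maps_direction (act g) i j.
Proof.
exact: (automorphism_maps_direction (actionK g actP) (actionVK g actP)
  (@act_adj g) (@act_adj g^-1)).
Qed.

Definition fixes_directions g : Prop := forall i, maps_direction (act g) i i.

Lemma fixes_directions1 : fixes_directions 1.
Proof. by case: actP => act1 _ i p q; rewrite !act1. Qed.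

Lemma fixes_directionsM g h :
  fixes_directions g -> fixes_directions h -> fixes_directions (g * h).
Proof. by case: actP => _ actM gP hP i p q /hP /gP; rewrite !actM. Qed.

Lemma fixes_directionsV g : fixes_directions g -> fixes_directions g^-1.
Proof.
move=> gP i p q pq; have [j gVj] := action_maps_direction g^-1 i.
have := gP j _ _ (gVj p q pq); rewrite !(actionVK _ actP) => /(dir_adj_uniq pq) ->.
exact: gVj.
Qed.

(** The element induces a permutation of the n directions, whose order divides n!. *)
Lemma fixes_directions_exp_fact g : fixes_directions (g ^+ n`!).
Proof.
have [act1 actM] := actP.
(* A direction without edges has no determined image; setting [s i = i] there makes [s] a
   permutation. *)
pose nontrivial i := exists p q : prod_vertex T, dir_adj i p q.
have [s sP] : {s : 'I_n -> 'I_n & forall i,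
    maps_direction (act g) i (s i) /\ (~ nontrivial i -> s i = i)}.
  apply: (@choice _ _ (fun i j =>
    maps_direction (act g) i j /\ (~ nontrivial i -> j = i))) => i.
  have [i_nt|i_nt] := pselect (nontrivial i); last first.
    by exists i; split=> // p q pq; case: i_nt; exists p, q.
  by have [j gj] := action_maps_direction g i; exists j.
have s_nt i : nontrivial i -> nontrivial (s i).
  by move=> [p [q pq]]; exists (act g p), (act g q); apply: (sP i).1.
have s_back i j : nontrivial i -> maps_direction (act g^-1) (s i) j -> i = j.
  move=> [p [q pq]] gVj; apply: (dir_adj_uniq pq).
  by have := gVj _ _ ((sP i).1 _ _ pq); rewrite !(actionK _ actP).
have s_inj : injective s.
  move=> i i' sii'.
  have [i_nt|i_nt] := pselect (nontrivial i);
    have [i'_nt|i'_nt] := pselect (nontrivial i').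
  - have [j gVj] := action_maps_direction g^-1 (s i).
    by rewrite (s_back i j) // (s_back i' j) // -sii'.
  - by case: (i'_nt); rewrite -((sP i').2 i'_nt) -sii'; apply: s_nt.
  - by case: (i_nt); rewrite -((sP i).2 i_nt) sii'; apply: s_nt.
  - by rewrite -((sP i).2 i_nt) sii' (sP i').2.
have expP k i : maps_direction (act (g ^+ k)) i ((perm s_inj ^+ k) i).
  elim: k i => [|k IH] i p q pq; first by rewrite !act1 perm1.
  by rewrite (expgS g) !actM expgSr permM permE; apply/(sP _).1/IH.
move=> i; have := expP n`! i.
suff -> : perm s_inj ^+ n`! = 1 by rewrite perm1.
by rewrite -card_Sn -cardsT expg_cardG // finset.in_setT.
Qed.

(** Moving [p] along directions other than [i] moves its image along those same directions, so
    coordinate [i] of the image does not change. *)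
Lemma fixes_directions_coord g i p p' :
  fixes_directions g -> p i = p' i -> act g p i = act g p' i.
Proof.
move=> gP pp'.
apply: (@prod_vertex_ind (predC1 i) (fun q => act g p i = act g q i) p) => //.
  by move=> j /negPn /eqP ->.
move=> j q q' /= ji qq' ->.
by have [_ ->] := gP _ _ _ qq'; rewrite // eq_sym.
Qed.

Lemma fixes_directions_preserves_factors (H : groupType) (phi : H -> G) :
  phi 1 = 1 -> {morph phi : x y / x * y} ->
  (forall h, fixes_directions (phi h)) ->
  preserves_factors (fun h => act (phi h)).
Proof.
move=> phi1 phiM phiP; have [act1 actM] := actP.
(* A base vertex, chosen from the nonempty trees; the action on the factor [T i] is read off the
   slice through it. *)
have [p0 _] : {p0 : forall i, T i & True}.
  exists (fun i => projT1 (cid (let: inhabits v := tree_inhabited (T i) in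
     ex_intro (fun=> True) v I))) => //.
pose rho i h (v : T i) := act (phi h) (dfwith p0 v) i.
have rhoE h p i : act (phi h) p i = rho i h (p i).
  by apply: fixes_directions_coord => //; rewrite dfwith_in.
have rhoP i : is_action (rho i).
  split=> [v|g h v]; first by rewrite /rho phi1 act1 dfwith_in.
  by rewrite {1}/rho phiM actM rhoE.
have rho_adj i h (u v : T i) : tree_adj u v -> tree_adj (rho i h u) (rho i h v).
  move=> uv; have := @dir_adj_dfwith i (dfwith p0 u) v.
  rewrite dfwith_in => /(_ uv) /(phiP h) [].
  by rewrite !rhoE !dfwith_in.
exists rho; split=> // i; split=> // h; split; first exact: action_bij.
move=> u v; apply/idP/idP; last exact: rho_adj.
by move=> /(rho_adj _ h^-1); rewrite !(actionK _ (rhoP i)).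
Qed.

End ProductActions.

End TreeProducts.

(** * Restriction to the embedded copy of N *)

Lemma acts_properly_preserving_factors_sub (G H : groupType) (phi : H -> G)
    (psi : G -> H) n (T : 'I_n -> tree) (act : G -> prod_vertex T -> prod_vertex T) :
  phi 1 = 1 -> {morph phi : x y / x * y} -> cancel phi psi ->
  (forall i, locally_finite (T i)) -> prod_action act -> proper_action act ->
  (forall h, fixes_directions act (phi h)) ->
  acts_properly_preserving_factors H.
Proof.
move=> phi1 phiM phiK T_lf act_prod act_proper phiP.
exists n, T, (fun h => act (phi h)); split=> //.
- case: act_prod => [[act1 actM] act_auto]; split=> //; split=> [p|g h p].
    by rewrite phi1 act1.
  by rewrite phiM actM.
(* The stabiliser in [H] lies in the image under [psi] of the finite stabiliser in [G]. *)
- move=> p; apply: sub_finite_set (finite_image psi (act_proper p)) => h /= hp.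
  by exists (phi h).
- exact: fixes_directions_preserves_factors.
Qed.

Theorem corollary6p5 :
  ~ acts_properly_preserving_factors groupN ->
  forall (V : finType) (e : rel V),
    symmetric e -> irreflexive e ->
    induced_subgraph (@path_graph 4) e ->
    ~ acts_properly_preserving_factors (raag e) /\ ~ acts_properly (raag e).
Proof.
move=> N_not V e e_sym e_irr [f f_inj f_path].
suff proper_not : ~ acts_properly (raag e).
  by split=> // -[n [T [act [? ? ? _]]]]; apply: proper_not; exists n, T, act.
move=> [n [T [act [T_lf act_prod act_proper]]]]; apply: N_not.
have [phi [psi [phi1 phiM phiK phi_sub]]] :=
  (* The exponent in [groupN_embeds] is [m.+1], so this choice yields n!, which is positive. *)
  groupN_embeds e_irr f_inj f_path n`!.-1.
apply: (acts_properly_preserving_factors_sub phi1 phiM phiK T_lf act_prod) => //.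
apply: phi_sub => [|g h|g|v].
- exact: fixes_directions1.
- exact: fixes_directionsM.
- exact: fixes_directionsV.
- by rewrite prednK ?fact_gt0 //; apply: fixes_directions_exp_fact.
Qed.
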